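(* Let $1\le p<\infty$, $n\ge1$ and let $Y$ be a Banach space over $\mathbb{K}$. Every continuous $n$-linear operator $T:Y\times\cdots\times Y\to Y$ is factorable strongly $p$-summing if and only if $\dim Y<\infty$.
   Context: $\mathbb{K}=\mathbb{R}$ or $\mathbb{C}$. A continuous $n$-linear operator $T:X_1\times\cdots\times X_n\to Y$ between Banach spaces is factorable strongly $p$-summing if there is a constant $C\ge0$ such that for all positive integers $m_1,m_2$, all $x_{k,j}^i\in X_k$ and all scalars $\lambda_j^i$ ($1\le k\le n$, $1\le j\le m_1$, $1\le i\le m_2$), $$\left(\sum_{j=1}^{m_1}\Big\|\sum_{i=1}^{m_2}\lambda_j^iT(x_{1,j}^i,\dots,x_{n,j}^i)\Big\|^p\right)^{1/p}\le C\sup_{\|\varphi\|\le1}\left(\sum_{j=1}^{m_1}\Big|\sum_{i=1}^{m_2}\lambda_j^i\varphi(x_{1,j}^i,\dots,x_{n,j}^i)\Big|^p\right)^{1/p},$$ where the supremum is over all continuous $n$-linear forms $\varphi:X_1\times\cdots\times X_n\to\mathbb{K}$ of norm at most $1$. *)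

(* Defs.v *)
From HB Require Import structures.
From mathcomp Require Import all_boot all_order all_algebra.
From mathcomp Require Import complex.
From mathcomp Require Import all_classical all_reals all_analysis.

Set Implicit Arguments.
Unset Strict Implicit.
Unset Printing Implicit Defensive.

Import Order.TTheory GRing.Theory Num.Theory.
Import numFieldNormedType.Exports.

Local Open Scope classical_set_scope.
Local Open Scope complex_scope.
Local Open Scope ring_scope.

Variant scalar_kind := RealScalars | ComplexScalars.

Definition scalars (R : realType) (F : scalar_kind) : numFieldType :=
  match F with
  | RealScalars => R
  | ComplexScalars => R[i]
  end.

Definition scalar_re (R : realType) (F : scalar_kind) : scalars R F -> R :=
  match F return scalars R F -> R with
  | RealScalars => fun x => x
  | ComplexScalars => fun x => complex.Re x
  end.

Section Defs.
Context {R : realType} {F : scalar_kind}.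
Local Notation K := (scalars R F).

(* The library norm `|x| takes its values in K, where it is a nonnegative
   real; [rnorm x] is the same number as an element of R. *)
Definition rnorm (V : normedModType K) (x : V) : R := scalar_re `|x|.

Definition finite_dimensional (V : lmodType K) : Prop :=
  exists d : nat, inhabited (Vector.axiom d V).

Section Multilinear.
Context {n : nat} {X : 'I_n -> normedModType K} {Y : normedModType K}.

Definition multilinear (T : (forall k, X k) -> Y) : Prop :=
  forall (k : 'I_n) (x : forall k, X k), linear (fun u : X k => T (dfwith x k u)).

Definition continuous_multilinear (T : prod_topology X -> Y) : Prop :=
  multilinear T /\ continuous T.

Definition multilinear_norm (T : (forall k, X k) -> Y) : \bar R :=
  ereal_sup [set (rnorm (T x))%:E | x in [set x | forall k, rnorm (x k) <= 1]].

End Multilinear.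

Definition unit_forms {n : nat} (X : 'I_n -> normedModType K) :
    set ((forall k, X k) -> K^o) :=
  [set phi | continuous_multilinear phi /\ (multilinear_norm phi <= 1%:E)%E].
Arguments unit_forms {n} X _.

(* The supremum is taken in the extended reals, so that it is the genuine
   supremum without any boundedness side condition. *)
Definition factorable_strongly_summing {n : nat}
    {X : 'I_n -> completeNormedModType K} {Y : completeNormedModType K}
    (p : R) (T : (forall k, X k) -> Y) : Prop :=
  exists2 C : R, 0 <= C &
    forall m1 m2 : nat, (0 < m1)%N -> (0 < m2)%N ->
    forall (x : 'I_m1 -> 'I_m2 -> forall k, X k) (lambda : 'I_m1 -> 'I_m2 -> K),
    (((\sum_(j < m1) rnorm (\sum_(i < m2) lambda j i *: T (x j i)) `^ p)
        `^ p^-1)%:E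
     <= C%:E * ereal_sup
       [set ((\sum_(j < m1)
                rnorm (\sum_(i < m2) lambda j i *: phi (x j i)) `^ p)
               `^ p^-1)%:E | phi in unit_forms (fun k => X k)])%E.

End Defs.

(* Main.v *)
Require Import Defs.
From HB Require Import structures.
From mathcomp Require Import all_boot all_order all_algebra.
From mathcomp Require Import perm complex ring lra.
From mathcomp Require Import all_classical all_reals all_analysis.

Set Implicit Arguments.
Unset Strict Implicit.
Unset Printing Implicit Defensive.

Import Order.TTheory GRing.Theory Num.Theory.
Import numFieldNormedType.Exports.

Local Open Scope classical_set_scope.
Local Open Scope ring_scope.

(** Throughout, the scalar field is the real or the complex numbers; [rnorm x]
is the norm of [x] as a real number and [scalar_of] embeds the reals into the
scalar field.

If Y has finite dimension, the coordinate maps of a basis [e] are bounded, by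
equivalence of norms on a real coordinate space ([is_norm_lower_bound]).
Composing T with the coordinate maps and normalising gives finitely many
multilinear forms [phi l] in the unit ball, and T is a fixed multiple of
[\sum_l phi l *: e l]. The l^p norm of the left-hand side is then at most a
constant times the sum over [l] of the l^p norms belonging to the single forms
[phi l] ([lp_norm_le_sum]), each of which is below the supremum.

If Y has infinite dimension, take a unit vector [a], a bounded linear form
[psi] with [psi a != 0] (Hahn-Banach), and the operator which maps [x] to the
product of the [psi (x k)], [k != k0], times [x k0]. On tuples equal to [a]
outside the slot [k0] it is a nonzero multiple of the identity of Y, while
a multilinear form of norm at most 1 becomes a linear form of norm at most 1.
Were the operator factorable strongly p-summing, the identity of Y would
therefore be absolutely p-summing; the Dvoretzky-Rogers theorem forbids this.

For the latter, every norm [q] on a real coordinate space of dimension [m + m]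
admits [m] vectors [y_s] with [q (y_s) >= 1/4] and
[q (\sum_s b_s y_s) <= (\sum_s b_s^2)^(1/2)] ([dvoretzky_rogers]). They are
rows of a matrix [A] whose determinant is almost maximal in absolute value
among all matrices with [q (a *m A) <= |a|]. If [q (b *m A)] were at most
[|b| / 4] for every [b] whose first [s < m] entries vanish, then doubling the
remaining rows of [A] and multiplying everything by 4/5 would give an admissible
matrix of larger determinant. So there is a unit vector [b] supported on the last
entries with [q (b *m A) > 1/4], and a reflection which fixes the first [s]
coordinate vectors and exchanges the next one with [b] makes [b *m A] the row
number [s] of an admissible matrix with the same determinant up to sign.
Transported to Y, such vectors satisfy [\sum_s |f (y_s)|^2 <= 4] for each linear
form [f] of norm at most 1, so [\sum_s |f (y_s)|^p] is [o(m)] uniformly in [f],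
whereas [\sum_s |y_s|^p >= m / 4^p]. *)

(** * Norms on real row vectors *)

Section RealNorms.
Variable R : realType.

(** Norms on real row vectors, as a predicate on functions. Nonnegativity is a
consequence ([is_norm_ge0]). *)
Definition is_norm (N : nat) (q : 'rV[R]_N -> R) : Prop :=
  [/\ forall a b, q (a + b) <= q a + q b,
      forall t a, q (t *: a) = `|t| * q a
    & forall a, q a = 0 -> a = 0].

Section OneNorm.
Variables (N : nat) (q : 'rV[R]_N -> R).
Hypothesis q_norm : is_norm q.

Let qD : forall a b, q (a + b) <= q a + q b. Proof. by case: q_norm. Qed.
Let qZ : forall t a, q (t *: a) = `|t| * q a. Proof. by case: q_norm. Qed.

Lemma is_norm0 : q 0 = 0.
Proof. by rewrite -(scale0r (0 : 'rV[R]_N)) qZ normr0 mul0r. Qed.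

Lemma is_normN a : q (- a) = q a.
Proof. by rewrite -scaleN1r qZ normrN1 mul1r. Qed.

Lemma is_norm_ge0 a : 0 <= q a.
Proof.
have := qD a (- a); rewrite subrr is_norm0 is_normN; lra.
Qed.

Lemma is_norm_gt0 a : a != 0 -> 0 < q a.
Proof.
move=> a0; rewrite lt_neqAle is_norm_ge0 andbT eq_sym.
by apply: contra_neq a0; case: q_norm => _ _; apply.
Qed.

Lemma is_norm_le_coord (a : 'rV[R]_N) t : (forall i, `|a 0 i| <= t) ->
  q a <= t * \sum_i q (delta_mx 0 i).
Proof.
move=> at_; rewrite [X in q X]row_sum_delta mulr_sumr.
elim/big_ind2 : _ => [|x1 x2 y1 y2 h1 h2|i _]; first by rewrite is_norm0.
  by rewrite (le_trans (qD _ _))// lerD.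
by rewrite qZ ler_wpM2r// is_norm_ge0.
Qed.

Lemma is_norm_continuous : continuous q.
Proof.
set G := \sum_i q (delta_mx 0 i).
have G0 : 0 <= G by apply: sumr_ge0 => i _; exact: is_norm_ge0.
have lip a b : `|q a - q b| <= (G + 1) * `|a - b|.
  have h : q (a - b) <= `|a - b| * G.
    apply: is_norm_le_coord => i.
    rewrite [leRHS]/Num.norm /= mx_normrE; apply/bigmax_geP; right => /=.
    by exists (0, i).
  have h1 := qD (a - b) b; have h2 := qD (b - a) a.
  have h3 := is_normN (a - b); rewrite opprB in h3.
  rewrite !subrK in h1 h2.
  have n0 : 0 <= `|a - b| by [].
  rewrite ler_norml; apply/andP; split; nra.
move=> a; apply/(@cvgrPdist_lt R R^o _ _ (nbhs_filter a) q (q a)) => e e0.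
have e1 : 0 < (G + 1)^-1 * e by rewrite mulr_gt0// invr_gt0 ltr_wpDl.
apply: filterS (nbhsx_ballx a _ e1) => b; rewrite -ball_normE /= => ab.
by rewrite (le_lt_trans (lip a b))// -ltr_pdivlMl ?ltr_wpDl.
Qed.

(** Equivalence with the supremum norm, by compactness of its unit sphere. *)
Lemma is_norm_lower_bound :
  exists2 c, 0 < c & forall (a : 'rV[R]_N) i, c * `|a 0 i| <= q a.
Proof.
have [N0|N0] := eqVneq N 0%N.
  by exists 1 => // a i; have := ltn_ord i; rewrite {2}N0.
have i0 : 'I_N by apply: (@Ordinal _ 0); rewrite lt0n.
pose S := [set a : 'rV[R]_N | `|a| = 1].
have Sclosed : closed S.
  apply: (@closed_comp _ _ (fun a : 'rV[R]_N => `|a|) [set x | x = 1]).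
    by move=> a _; exact: norm_continuous.
  exact: closed_eq.
have Sbnd : bounded_set S.
  by exists 1; split => // x x1 a /= ->; exact: ltW.
have [||c Sc cmin] := @EVT_min_rV R N q S _ (bounded_closed_compact Sbnd Sclosed).
  exists (delta_mx 0 i0); rewrite /S /=.
  apply/eqP; rewrite eq_le; apply/andP; split.
    rewrite [leLHS]/Num.norm /= mx_normrE; apply/bigmax_leP.
    split => // -[i j] _ /=.
    by rewrite mxE; case: (_ && _); rewrite ?normr1 ?normr0.
  rewrite [leRHS]/Num.norm /= mx_normrE; apply/bigmax_geP; right => /=.
  by exists (0, i0) => //=; rewrite mxE !eqxx normr1.
  exact: continuous_subspaceT is_norm_continuous.
exists (q c).
  apply: is_norm_gt0; apply/eqP => c0; move: Sc; rewrite /S inE /= c0 normr0.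
  by move/eqP; rewrite eq_sym oner_eq0.
move=> a i; have [->|a0] := eqVneq a 0; first by rewrite mxE normr0 mulr0 is_norm0.
have ha : q c <= q (`|a|^-1 *: a).
  apply: cmin; rewrite /S inE /=.
  by rewrite normrZ normfV normr_id mulVf// normr_eq0.
rewrite qZ normfV normr_id ler_pdivlMl ?normr_gt0// in ha.
rewrite (le_trans _ ha)// mulrC ler_wpM2r ?is_norm_ge0//.
rewrite [leRHS]/Num.norm /= mx_normrE; apply/bigmax_geP; right => /=.
by exists (0, i).
Qed.

End OneNorm.
End RealNorms.

(** * Euclidean length and reflections *)

Section Euclid.
Variables (R : realType) (N : nat).
Implicit Types a b w : 'rV[R]_N.

(** The square of the Euclidean length of a row vector. *)
Definition sqn a : R := \sum_j a 0 j ^+ 2.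

Lemma sqnE a : a *m a^T = (sqn a)%:M.
Proof.
apply/matrixP => i j; rewrite !ord1 !mxE eqxx mulr1n.
by apply: eq_bigr => k _; rewrite mxE expr2.
Qed.

Lemma sqn_ge0 a : 0 <= sqn a.
Proof. by apply: sumr_ge0 => i _; exact: sqr_ge0. Qed.

Lemma sqn_coord a j : a 0 j ^+ 2 <= sqn a.
Proof.
by rewrite /sqn (bigD1 j)//= lerDl sumr_ge0// => i _; exact: sqr_ge0.
Qed.

Lemma sqn_eq0 a : sqn a = 0 -> a = 0.
Proof.
move=> a0; apply/rowP => j; rewrite mxE; apply/eqP.
by rewrite -sqrf_eq0 eq_le sqr_ge0 andbT -a0 sqn_coord.
Qed.

Lemma sqnZ t a : sqn (t *: a) = t ^+ 2 * sqn a.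
Proof. by rewrite mulr_sumr; apply: eq_bigr => j _; rewrite mxE exprMn. Qed.

Lemma sqn_delta i : sqn (delta_mx 0 i) = 1.
Proof.
rewrite /sqn (bigD1 i)//= mxE !eqxx expr1n big1 ?addr0// => j ji.
by rewrite mxE (negbTE ji) andbF expr0n.
Qed.

(** The orthogonal reflection in the hyperplane orthogonal to [w], acting on row
vectors from the right; it is of interest for [w != 0] only. *)
Definition reflection w : 'M[R]_N := 1%:M - (2 / sqn w) *: (w^T *m w).

Lemma reflection_tr w : (reflection w)^T = reflection w.
Proof. by rewrite /reflection linearB linearZ /= trmx1 trmx_mul trmxK. Qed.

Lemma reflectionK w : w != 0 -> reflection w *m reflection w = 1%:M.
Proof.
move=> w0; have s0 : sqn w != 0 by apply: contra_neq w0; exact: sqn_eq0.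
rewrite /reflection; set M := w^T *m w; set c := 2 / sqn w.
have MM : M *m M = sqn w *: M.
  by rewrite mulmxA -(mulmxA w^T) sqnE mul_mx_scalar scalemxAl.
rewrite mulmxBl mul1mx mulmxBr mulmx1 -scalemxAl -scalemxAr MM !scalerA.
rewrite (_ : c * c * sqn w = c + c); last by rewrite /c; field.
by rewrite scalerDl opprB addrK subrK.
Qed.

Lemma sqn_reflection w a : w != 0 -> sqn (a *m reflection w) = sqn a.
Proof.
move=> w0; have : (sqn (a *m reflection w))%:M = (sqn a)%:M :> 'M[R]_1.
  by rewrite -!sqnE trmx_mul reflection_tr mulmxA -(mulmxA a) reflectionK// mulmx1.
by move/matrixP/(_ 0 0); rewrite !mxE eqxx !mulr1n.
Qed.

Lemma norm_det_reflection w : w != 0 -> `|\det (reflection w)| = 1.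
Proof.
move=> w0; apply/eqP; rewrite -sqr_norm_eq1.
by rewrite expr2 -det_mulmx reflectionK// det1.
Qed.

Lemma reflection_fix w i : w 0 i = 0 ->
  (delta_mx 0 i : 'rV_N) *m reflection w = delta_mx 0 i.
Proof.
move=> wi; rewrite /reflection mulmxBr mulmx1 -scalemxAr mulmxA.
rewrite (_ : (delta_mx 0 i : 'rV_N) *m w^T = 0) ?mul0mx ?scaler0 ?subr0//.
by rewrite -rowE; apply/matrixP => k l; rewrite !mxE !ord1.
Qed.

(** For a unit vector [b], the reflection along [b - e_i] maps [e_i] to [b]. *)
Lemma reflection_swap b i : sqn b = 1 -> b != delta_mx 0 i ->
  (delta_mx 0 i : 'rV_N) *m reflection (b - delta_mx 0 i) = b.
Proof.
move=> b1 bi; set w := b - _.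
have w0 : w != 0 by rewrite subr_eq0.
have s0 : sqn w != 0 by apply: contra_neq w0; exact: sqn_eq0.
have sw : sqn w = - 2 * w 0 i.
  rewrite /sqn /w (bigD1 i)//=.
  rewrite (eq_bigr (fun j => b 0 j ^+ 2)); last first.
    by move=> j ji; rewrite !mxE (negbTE ji) andbF subr0.
  move: b1; rewrite /sqn (bigD1 i)//= !mxE !eqxx /=; set S := \sum_(j | _) _.
  move=> b1; have -> : S = 1 - b 0 i ^+ 2 by rewrite -b1 addrAC subrr add0r.
  ring.
rewrite /reflection mulmxBr mulmx1 -scalemxAr mulmxA.
rewrite (_ : (delta_mx 0 i : 'rV_N) *m w^T = (w 0 i)%:M).
  rewrite mul_scalar_mx scalerA.
  rewrite (_ : 2 / sqn w * w 0 i = -1) ?scaleN1r ?opprK; last first.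
    rewrite [X in _ / X]sw; field; move: s0; rewrite sw.
    by apply: contra_neq => ->; rewrite mulr0.
  by rewrite /w addrC subrK.
by rewrite -rowE; apply/matrixP => k l; rewrite !mxE !ord1 mulr1n.
Qed.

End Euclid.

(** * The Dvoretzky-Rogers lemma *)

Section DvoretzkyRogers.
Variables (R : realType).

(** The map [a |-> a *m A] is a contraction from the Euclidean norm to [q];
both norms are squared to avoid square roots. *)
Definition contractive N (q : 'rV[R]_N -> R) (A : 'M[R]_N) : Prop :=
  forall a : 'rV[R]_N, q (a *m A) ^+ 2 <= sqn a.

Lemma contractive_reflection N (q : 'rV[R]_N -> R) A w :
  w != 0 -> contractive q A -> contractive q (reflection w *m A).
Proof.
by move=> w0 cA a; rewrite mulmxA (le_trans (cA _))// sqn_reflection.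
Qed.

Lemma contractive_det_bounded N (q : 'rV[R]_N -> R) : is_norm q ->
  exists M, forall A, contractive q A -> `|\det A| <= M.
Proof.
move=> q_norm; have [c c0 cq] := is_norm_lower_bound q_norm.
exists (\sum_(s : 'S_N) \prod_(i < N) c^-1) => A cA.
have entry i j : `|A i j| <= c^-1.
  rewrite -[leRHS]mulr1 ler_pdivlMl//.
  have := cq (row i A) j; rewrite mxE => /le_trans; apply.
  have := cA (delta_mx 0 i); rewrite sqn_delta -rowE => h.
  by rewrite -(@ler_pXn2r _ 2)// ?nnegrE ?is_norm_ge0// expr1n.
rewrite (le_trans (ler_norm_sum _ _ _))//; apply: ler_sum => s _.
rewrite normrM normr_prod normrX normrN1 expr1n mul1r.
by apply: ler_prod => i _; rewrite normr_ge0 entry.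
Qed.

Lemma contractive_det_neq0 N (q : 'rV[R]_N -> R) : is_norm q ->
  exists2 A, contractive q A & \det A != 0.
Proof.
move=> q_norm; case: (q_norm) => _ qZ _.
set G := \sum_(i < N) q (delta_mx 0 i).
have G0 : 0 <= G by apply: sumr_ge0 => i _; exact: is_norm_ge0.
exists ((G + 1)^-1)%:M; last first.
  by rewrite det_scalar expf_neq0// invr_eq0 gt_eqF// ltr_wpDl.
move=> a; rewrite mul_mx_scalar qZ ger0_norm ?invr_ge0 ?addr_ge0//.
rewrite exprMn exprVn ler_pdivrMl ?exprn_gt0 ?ltr_wpDl//.
have : q a <= Num.sqrt (sqn a) * G.
  apply: is_norm_le_coord => // i.
  by rewrite -(ler_pXn2r (n := 2))// ?nnegrE ?sqrtr_ge0// real_normK ?num_real//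
             sqr_sqrtr ?sqn_ge0// sqn_coord.
rewrite -(ler_pXn2r (n := 2)) ?nnegrE ?is_norm_ge0 ?mulr_ge0 ?sqrtr_ge0//.
rewrite exprMn sqr_sqrtr ?sqn_ge0// => /le_trans; apply.
have := sqn_ge0 a; nra.
Qed.

(** The ratio 10/9 stays below the factor 32/25 gained in [contractive_stretch],
which is why an almost maximal determinant suffices. *)
Lemma contractive_det_almost_max N (q : 'rV[R]_N -> R) : is_norm q ->
  exists A, [/\ contractive q A, 0 < `|\det A| &
    forall B, contractive q B -> 9 * `|\det B| <= 10 * `|\det A|].
Proof.
move=> q_norm; have [M hM] := contractive_det_bounded q_norm.
have [A0 cA0 dA0] := contractive_det_neq0 q_norm.
pose D := [set `|\det A| | A in contractive q].
have supD : has_sup D.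
  split; first by exists `|\det A0|, A0.
  by exists M => _ [A cA <-]; exact: hM.
have s0 : 0 < sup D.
  have : 0 < `|\det A0| by rewrite normr_gt0.
  by move=> /lt_le_trans; apply; apply: sup_upper_bound => //; exists A0.
have [|_ [A cA <-] hA] := @sup_adherent _ D (sup D / 10) _ supD.
  by rewrite divr_gt0.
exists A; split=> //; first by lra.
move=> B cB; have : `|\det B| <= sup D by apply: sup_upper_bound => //; exists B.
lra.
Qed.

(** If [A] is small on the vectors supported on the coordinates [j >= s], then
stretching these coordinates increases the determinant: the new matrix is
[diag_mx d *m A] with [d j = 8/5] for [j >= s] and [d j = 4/5] otherwise, and
at least half of the [m + m] coordinates are stretched. *)
Lemma contractive_stretch m s (q : 'rV[R]_(m + m) -> R) A : is_norm q ->
  contractive q A -> (s < m)%N ->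
  (forall b : 'rV[R]_(m + m), (forall j : 'I_(m + m), (j < s)%N -> b 0 j = 0) ->
     16 * q (b *m A) ^+ 2 <= sqn b) ->
  exists2 B, contractive q B & 32 * `|\det A| <= 25 * `|\det B|.
Proof.
move=> q_norm cA sm small; case: (q_norm) => qD qZ _.
pose d : 'rV[R]_(m + m) := \row_j (4 / 5 * (1 + (s <= j)%:R)).
exists (diag_mx d *m A).
  move=> a; pose b : 'rV[R]_(m + m) := \row_j (a 0 j * (s <= j)%:R).
  have -> : a *m (diag_mx d *m A) = (4 / 5) *: (a *m A + b *m A).
    rewrite mulmxA -mulmxDl scalemxAl; congr (_ *m _).
    apply/rowP => j; rewrite mul_mx_diag !mxE; ring.
  have b_small : 16 * q (b *m A) ^+ 2 <= sqn b.
    by apply: small => j js; rewrite mxE leqNgt js mulr0.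
  have ba : sqn b <= sqn a.
    apply: ler_sum => j _; rewrite mxE; case: (s <= j)%N; rewrite ?mulr1//.
    by rewrite mulr0 expr0n sqr_ge0.
  have ha := cA a; have h := qD (a *m A) (b *m A).
  have h1 := is_norm_ge0 q_norm (a *m A); have h2 := is_norm_ge0 q_norm (b *m A).
  have h3 := is_norm_ge0 q_norm (a *m A + b *m A).
  rewrite qZ ger0_norm; last by lra.
  set x := q (a *m A) in ha h h1 *; set y := q (b *m A) in b_small h h2 *.
  set z := q _ in h h3 *.
  have zz : z ^+ 2 <= (x + y) ^+ 2 by rewrite ler_pXn2r// nnegrE// addr_ge0.
  (* [(x + y)^2 <= 5/4 * x^2 + 5 * y^2] and [y^2 <= |a|^2 / 16] *)
  have := sqr_ge0 (x - 4 * y); nra.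
rewrite det_mulmx det_diag normrM ger0_norm; last first.
  by apply: prodr_ge0 => j _; rewrite mxE mulr_ge0// addr_ge0.
rewrite mulrA ler_wpM2r//.
suff : (32 / 25) <= \prod_i d 0 i by lra.
rewrite big_split_ord /=.
have m0 : (0 < m)%N by exact: leq_ltn_trans sm.
apply: (@le_trans _ _ ((4 / 5) ^+ m * (8 / 5) ^+ m)).
  rewrite -exprMn (_ : 4 / 5 * (8 / 5) = 32 / 25 :> R); last by field.
  by rewrite -[leLHS]expr1 ler_weXn2l//; lra.
apply: ler_pM; rewrite ?exprn_ge0//.
  rewrite -[X in _ ^+ X]card_ord -prodr_const; apply: ler_prod => j _.
  rewrite mxE; case: (s <= _)%N; rewrite /= ?mulr1n ?mulr0n; apply/andP; split; lra.
rewrite -[X in _ ^+ X]card_ord -prodr_const; apply: ler_prod => j _.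
rewrite mxE /= (_ : (s <= m + j)%N = true); last first.
  by rewrite (leq_trans (ltnW sm))// leq_addr.
by rewrite mulr1n; apply/andP; split; lra.
Qed.

(** The Dvoretzky-Rogers lemma in dimension [m + m]: the first [m] coordinate
vectors have images of norm at least 1/4 under a contraction. *)
Theorem dvoretzky_rogers m (q : 'rV[R]_(m + m) -> R) : is_norm q ->
  exists2 A : 'M[R]_(m + m), contractive q A &
    forall i : 'I_(m + m), (i < m)%N -> 1 <= 16 * q (row i A) ^+ 2.
Proof.
move=> q_norm; case: (q_norm) => _ qZ _.
have [A0 [cA0 dA0 maxA0]] := contractive_det_almost_max q_norm.
suff H s : (s <= m)%N -> exists A, [/\ contractive q A,
    `|\det A| = `|\det A0| &
    forall i : 'I_(m + m), (i < s)%N -> 1 <= 16 * q (row i A) ^+ 2].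
  by have [A [cA _ hA]] := H m (leqnn m); exists A.
(* the determinant keeps its absolute value, so that it stays almost maximal *)
elim: s => [_|s IH sm]; first by exists A0; split.
have [A [cA dA hA]] := IH (ltnW sm).
have [b [bs b1 qb]] : exists b : 'rV[R]_(m + m),
    [/\ forall j : 'I_(m + m), (j < s)%N -> b 0 j = 0, sqn b = 1
      & 1 <= 16 * q (b *m A) ^+ 2].
  apply: contrapT => nob.
  have [|B cB hB] := contractive_stretch q_norm cA sm; last first.
    by have := maxA0 _ cB; rewrite dA in hB; lra.
  move=> b bs; rewrite leNgt; apply/negP => hb; apply: nob.
  have b0 : 0 < sqn b.
    rewrite lt_neqAle sqn_ge0 andbT eq_sym; apply/eqP => /sqn_eq0 b0.
    move: hb; rewrite b0 mul0mx (is_norm0 q_norm).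
    by rewrite expr0n mulr0 ltNge sqn_ge0.
  exists ((Num.sqrt (sqn b))^-1 *: b); split.
  - by move=> j js; rewrite mxE bs// mulr0.
  - by rewrite sqnZ exprVn sqr_sqrtr ?sqn_ge0// mulVf// gt_eqF.
  - rewrite -scalemxAl qZ exprMn real_normK ?num_real// exprVn sqr_sqrtr ?sqn_ge0//.
    by rewrite mulrCA ler_pdivlMl// mulr1 ltW.
have smm : (s < m + m)%N by rewrite (leq_trans sm)// leq_addr.
pose i0 := Ordinal smm.
have rows (B : 'M[R]_(m + m)) : row i0 B = b *m A ->
    (forall i : 'I_(m + m), (i < s)%N -> row i B = row i A) ->
    forall i : 'I_(m + m), (i < s.+1)%N -> 1 <= 16 * q (row i B) ^+ 2.
  move=> B0 Bs i; rewrite ltnS leq_eqVlt => /orP[/eqP is_|is_].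
    by rewrite (_ : i = i0) ?B0//; exact: val_inj.
  by rewrite Bs// hA.
have [bi|bi] := eqVneq b (delta_mx 0 i0).
  by exists A; split=> //; apply: rows => //; rewrite rowE -bi.
have w0 : b - delta_mx 0 i0 != 0 by rewrite subr_eq0.
exists (reflection (b - delta_mx 0 i0) *m A); split.
- exact: contractive_reflection.
- by rewrite det_mulmx normrM norm_det_reflection// mul1r.
- apply: rows; first by rewrite rowE mulmxA reflection_swap.
  move=> i is_; rewrite !rowE mulmxA reflection_fix//.
  rewrite !mxE bs// eqxx /= (_ : (i == i0) = false) ?subr0//.
  by apply/negbTE; rewrite neq_ltn is_.
Qed.

End DvoretzkyRogers.

(** * Real numbers inside the scalar field, real-valued norms *)

Lemma normc_le_ReIm (R : realType) (p q : R) :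
  complex.Re `|Complex p q| <= `|p| + `|q|.
Proof.
rewrite normc_def /= -(ler_pXn2r (n := 2)) ?nnegrE ?sqrtr_ge0 ?addr_ge0//.
rewrite sqr_sqrtr ?addr_ge0 ?sqr_ge0// sqrrD !real_normK ?num_real//.
have : 0 <= `|p| * `|q| by rewrite mulr_ge0.
lra.
Qed.

Lemma normc_i (R : realType) : `|Complex (0 : R) 1| = 1.
Proof. by rewrite normc_def /= expr0n expr1n add0r sqrtr1. Qed.

(** The embedding of the real numbers into the scalar field. *)
Definition scalar_of (R : realType) (F : scalar_kind) : R -> scalars R F :=
  match F return R -> scalars R F with
  | RealScalars => fun r => r
  | ComplexScalars => fun r => real_complex R r
  end.

Section Scalars.
Variables (R : realType) (F : scalar_kind).
Local Notation K := (scalars R F).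
Local Notation iota := (scalar_of (R := R) F).
Implicit Types (r s : R) (k : K).

Lemma scalar_of1 : iota 1 = 1.
Proof. by case: F => //=; rewrite rmorph1. Qed.

Lemma scalar_of0 : iota 0 = 0.
Proof. by case: F => //=; rewrite rmorph0. Qed.

Lemma scalar_ofD r s : iota (r + s) = iota r + iota s.
Proof. by case: F => //=; rewrite rmorphD. Qed.

Lemma scalar_ofM r s : iota (r * s) = iota r * iota s.
Proof. by case: F => //=; rewrite rmorphM. Qed.

Lemma scalar_ofN r : iota (- r) = - iota r.
Proof. by case: F => //=; rewrite rmorphN. Qed.

Lemma scalar_ofX r n : iota (r ^+ n) = iota r ^+ n.
Proof.
by elim: n => [|n IH]; rewrite ?expr0 ?scalar_of1// !exprS scalar_ofM IH.
Qed.

Lemma scalar_of_eq0 r : (iota r == 0) = (r == 0).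
Proof. by case: F => //=; rewrite fmorph_eq0. Qed.

Lemma ler_scalar_of r s : (iota r <= iota s) = (r <= s).
Proof. by case: F => //=; rewrite lecR. Qed.

Lemma ltr_scalar_of r s : (iota r < iota s) = (r < s).
Proof. by case: F => //=; rewrite ltcR. Qed.

Lemma norm_scalar_of r : `|iota r| = iota `|r|.
Proof. by case: F => //=; rewrite normc_def/= expr0n addr0 sqrtr_sqr. Qed.

Lemma scalar_re_of r : scalar_re (iota r) = r.
Proof. by case: F. Qed.

Lemma scalar_reD : {morph @scalar_re R F : k l / k + l}.
Proof. by case: F => //= -[? ?] [? ?]. Qed.

Lemma scalar_reM r k : scalar_re (iota r * k) = r * scalar_re k.
Proof. by case: F k => //= -[x y] /=; rewrite mul0r subr0. Qed.

Lemma scalar_re_ge0K k : 0 <= k -> iota (scalar_re k) = k.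
Proof.
by case: F k => //= -[x y]; rewrite lecE /= => /andP[/eqP -> _].
Qed.

Lemma scalar_re_le k : `|scalar_re k| <= scalar_re `|k|.
Proof.
case: F k => [k|[x y]]; first exact: lexx.
change (`|x| <= complex.Re `|Complex x y|); rewrite normc_def /=.
by rewrite -sqrtr_sqr ler_wsqrtr// lerDl sqr_ge0.
Qed.

(** The element [u] is the imaginary unit over the complex numbers, where
[scalar_re (u * k)] is minus the imaginary part of [k]; over the reals [u = 1]
serves as well. *)
Lemma scalar_imaginary_unit : exists u : K, `|u| = 1 /\
  forall k, scalar_re `|k| <= `|scalar_re k| + `|scalar_re (u * k)|.
Proof.
case: F.
  by exists 1; rewrite normr1; split => // k; rewrite mul1r lerDl.
exists (Complex 0 1); split; first exact: normc_i.
move=> [x y].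
change (complex.Re `|Complex x y| <= `|x| + `|0 * x - 1 * y|).
by rewrite mul0r mul1r sub0r normrN normc_le_ReIm.
Qed.

Section Norm.
Variable V : normedModType K.
Implicit Types x y : V.

Lemma normE x : `|x| = iota (rnorm x).
Proof. by rewrite scalar_re_ge0K. Qed.

Lemma rnorm_ge0 x : 0 <= rnorm x.
Proof. by rewrite -(ler_scalar_of) -normE scalar_of0. Qed.

Lemma rnormD x y : rnorm (x + y) <= rnorm x + rnorm y.
Proof. by rewrite -ler_scalar_of scalar_ofD -!normE ler_normD. Qed.

Lemma rnormZ k x : rnorm (k *: x) = rnorm (k : K^o) * rnorm x.
Proof.
rewrite /rnorm normrZ -[X in scalar_re (X * _)]scalar_re_ge0K//.
by rewrite scalar_reM.
Qed.

Lemma rnormN x : rnorm (- x) = rnorm x.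
Proof. by rewrite /rnorm normrN. Qed.

Lemma rnorm_scalar_of r : rnorm (iota r : K^o) = `|r|.
Proof. by rewrite /rnorm norm_scalar_of scalar_re_of. Qed.

Lemma rnormZ_real r x : rnorm (iota r *: x) = `|r| * rnorm x.
Proof. by rewrite rnormZ rnorm_scalar_of. Qed.

Lemma rnorm0 : rnorm (0 : V) = 0.
Proof. by rewrite /rnorm normr0 -scalar_of0 scalar_re_of. Qed.

Lemma rnorm_eq0 x : (rnorm x == 0) = (x == 0).
Proof. by rewrite -scalar_of_eq0 -normE normr_eq0. Qed.

Lemma rnorm_sum (I : Type) (r : seq I) (P : pred I) (f : I -> V) :
  rnorm (\sum_(i <- r | P i) f i) <= \sum_(i <- r | P i) rnorm (f i).
Proof.
elim/big_ind2 : _ => [|x1 x2 y1 y2 h1 h2|//]; first by rewrite rnorm0.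
by rewrite (le_trans (rnormD _ _))// lerD.
Qed.

(** Convergence in a normed space, tested with real radii. *)
Lemma cvg_rnormP (T : Type) (G : set_system T) (FG : Filter G) (f : T -> V) x :
  f @ G --> x <-> forall e : R, 0 < e -> \forall t \near G, rnorm (x - f t) < e.
Proof.
split=> [/cvgrPdist_lt h e e0|h].
  have e0' : 0 < iota e by rewrite -scalar_of0 ltr_scalar_of.
  by apply: filterS (h _ e0') => t; rewrite normE ltr_scalar_of.
apply/cvgrPdist_lt => e e0.
have e0' : 0 < scalar_re e.
  by rewrite -ltr_scalar_of scalar_re_ge0K ?ltW// scalar_of0.
apply: filterS (h _ e0') => t.
by rewrite -[X in _ -> _ < X]scalar_re_ge0K ?ltW// normE ltr_scalar_of.
Qed.

End Norm.
End Scalars.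

(** * Linear maps and continuity *)

Section LinearMaps.
Variables (K : nzRingType) (U V : lmodType K) (f : U -> V).
Hypothesis f_lin : linear f.

Lemma linear_map0 : f 0 = 0.
Proof.
by apply: (addrI (1 *: f 0)); rewrite -f_lin scale1r !addr0 scale1r.
Qed.

Lemma linear_mapZ k x : f (k *: x) = k *: f x.
Proof. by rewrite -[X in f X]addr0 f_lin linear_map0 addr0. Qed.

Lemma linear_mapD x y : f (x + y) = f x + f y.
Proof. by rewrite -[x in LHS]scale1r f_lin scale1r. Qed.

Lemma linear_map_sum (I : Type) (r : seq I) (P : pred I) (c : I -> K) x :
  f (\sum_(i <- r | P i) c i *: x i) = \sum_(i <- r | P i) c i *: f (x i).
Proof.
elim/big_rec2 : _ => [|i y1 y2 _ <-]; first exact: linear_map0.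
by rewrite f_lin.
Qed.

End LinearMaps.

(** Convergence in a product is convergence of all coordinates. *)
Lemma cvg_prod_topology (I : eqType) (K : I -> topologicalType)
    (G : set_system (prod_topology K)) (f : prod_topology K) : Filter G ->
  (forall i, g i @[g --> G] --> f i) -> G --> f.
Proof.
move=> FG h; apply/cvg_sup => i A [_ [[U oU <-] Uf UA]].
by apply: filterS UA _; apply: (h i); exact: open_nbhs_nbhs.
Qed.

Section BoundedLinear.
Variables (R : realType) (F : scalar_kind).
Local Notation K := (scalars R F).

Lemma bounded_linear_comp_continuous (Z : topologicalType)
    (U W : normedModType K) (T : Z -> U) (f : U -> W) (L : R) :
  0 <= L -> linear f -> (forall u, rnorm (f u) <= L * rnorm u) ->
  continuous T -> continuous (f \o T).
Proof.
move=> L0 f_lin fL contT x; have cT : T z @[z --> x] --> T x := contT x.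
apply/(@cvg_rnormP R F W _ _ (nbhs_filter x)) => eps eps0.
have eps1 : 0 < eps / (L + 1) by rewrite divr_gt0// ltr_wpDl.
have := (@cvg_rnormP R F U _ _ (nbhs_filter x) T (T x)).1 cT _ eps1.
apply: filterS => z; rewrite ltr_pdivlMr ?ltr_wpDl// => hz /=.
have -> : f (T x) - f (T z) = f (T x - T z).
  by rewrite [in RHS]addrC -[- T z in RHS]scaleN1r f_lin scaleN1r addrC.
rewrite (le_lt_trans (fL _))//.
have := rnorm_ge0 (T x - T z); lra.
Qed.

End BoundedLinear.

(** * The Hahn-Banach theorem *)

Section HahnBanach.
Variables (R : realType) (F : scalar_kind) (V : normedModType (scalars R F)).
Local Notation iota := (scalar_of (R := R) F).

(** Partial real-linear functionals on [V] are represented by their graphs. *)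
Definition graph_linear (G : set (V * R)) : Prop :=
  forall x r y s t, G (x, r) -> G (y, s) -> G (iota t *: x + y, t * r + s).

Definition graph_dominated (G : set (V * R)) : Prop :=
  forall x r, G (x, r) -> r <= rnorm x.

(** The graph of a partial real-linear functional below the norm with value
[rnorm a] at [a]. Single-valuedness is not required: it follows from domination
([graph_functional]). *)
Definition functional_graph (a : V) (G : set (V * R)) : Prop :=
  [/\ G (a, rnorm a), graph_linear G & graph_dominated G].

Lemma functional_graph_line a :
  functional_graph a [set (iota t *: a, t * rnorm a) | t in [set: R]].
Proof.
split.
- by exists 1; rewrite ?scalar_of1 ?scale1r ?mul1r.
- move=> x r y s t [u _ [<- <-]] [v _ [<- <-]]; exists (t * u + v) => //.
  by rewrite scalar_ofD scalar_ofM scalerDl scalerA; congr (_, _); ring.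
- move=> x r [t _ [<- <-]]; rewrite rnormZ_real ler_wpM2r ?rnorm_ge0//.
  exact: ler_norm.
Qed.

Lemma graph_functional G x r s :
  graph_linear G -> graph_dominated G -> G (x, r) -> G (x, s) -> r = s.
Proof.
move=> lG dG.
have H r' s' : G (x, r') -> G (x, s') -> s' <= r'.
  move=> h1 h2; have := dG _ _ (lG _ _ _ _ (-1) h1 h2).
  rewrite scalar_ofN scalar_of1 scaleN1r addNr rnorm0; lra.
by move=> h1 h2; apply/eqP; rewrite eq_le !H.
Qed.

(** The one-step extension of the Hahn-Banach theorem: the value [c] at the new
vector [x0] is the supremum of [r - rnorm (x - x0)] over the graph. *)
Lemma functional_graph_extend a G x0 : functional_graph a G ->
  (forall r, ~ G (x0, r)) ->
  exists2 G', G `<` G' & functional_graph a G'.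
Proof.
move=> [Ga lG dG] Gx0.
have G0 : G (0, 0).
  have := lG _ _ _ _ (-1) Ga Ga.
  by rewrite scalar_ofN scalar_of1 scaleN1r addNr mulN1r addNr.
have GZ x r t : G (x, r) -> G (iota t *: x, t * r).
  by move=> h; have := lG _ _ _ _ t h G0; rewrite !addr0.
pose S := [set z.2 - rnorm (z.1 - x0) | z in G].
have Sub y s : G (y, s) -> ubound S (rnorm (y + x0) - s).
  move=> hy _ [[x r] hx <-] /=.
  have := dG _ _ (lG _ _ _ _ 1 hx hy); rewrite scalar_of1 scale1r mul1r.
  have := rnormD (x - x0) (y + x0).
  rewrite addrACA addNr addr0; lra.
have supS : has_sup S.
  split; first by exists (0 - rnorm (0 - x0)), (0, 0).
  by exists (rnorm (0 + x0) - 0); exact: Sub.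
pose c := sup S.
have c_ge x r : G (x, r) -> r - rnorm (x - x0) <= c.
  by move=> h; apply: sup_upper_bound => //; exists (x, r).
have c_le y s : G (y, s) -> c <= rnorm (y + x0) - s.
  by move=> h; apply: sup_le_ub (Sub _ _ h); case: supS.
exists [set z | exists x r t, G (x, r) /\ z = (x + iota t *: x0, r + t * c)].
  split.
    move=> [x r] h; exists x, r, 0; split=> //.
    by rewrite scalar_of0 scale0r mul0r !addr0.
  move=> h; apply: (Gx0 c); apply: h; exists 0, 0, 1; split=> //.
  by rewrite scalar_of1 scale1r add0r add0r mul1r.
split.
- exists a, (rnorm a), 0; split=> //.
  by rewrite scalar_of0 scale0r mul0r !addr0.
- move=> x' r' y' s' t [x [r [u [hx [-> ->]]]]] [y [s [v [hy [-> ->]]]]].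
  exists (iota t *: x + y), (t * r + s), (t * u + v); split; first exact: lG.
  congr (_, _); last by ring.
  by rewrite scalerDr scalar_ofD scalar_ofM scalerDl scalerA addrACA.
- move=> x' r' [x [r [t [hx [-> ->]]]]].
  have [t0|t0|->] := ltgtP t 0; last first.
  + by rewrite scalar_of0 scale0r mul0r !addr0 dG.
  + have := c_le _ _ (GZ _ _ t^-1 hx).
    have -> : x + iota t *: x0 = iota t *: (iota t^-1 *: x + x0).
      rewrite scalerDr scalerA -scalar_ofM mulfV ?gt_eqF//.
      by rewrite scalar_of1 scale1r.
    rewrite rnormZ_real gtr0_norm// -(ler_pM2l t0) mulrBr mulrA mulfV ?gt_eqF//.
    lra.
  + have t1 : 0 < - t by rewrite oppr_gt0.
    have := c_ge _ _ (GZ _ _ (- t)^-1 hx).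
    have -> : x + iota t *: x0 = iota (- t) *: (iota (- t)^-1 *: x - x0).
      rewrite scalerBr scalerA -scalar_ofM mulfV ?gt_eqF//.
      by rewrite scalar_of1 scale1r scalar_ofN scaleNr opprK.
    rewrite rnormZ_real gtr0_norm// -(ler_pM2l t1) mulrBr mulrA mulfV ?gt_eqF//.
    lra.
Qed.

(** A real-linear functional of norm at most 1 attaining its norm at [a]. *)
Lemma hahn_banach_real (a : V) : exists f : V -> R,
  [/\ forall t x y, f (iota t *: x + y) = t * f x + f y,
      forall x, `|f x| <= rnorm x & f a = rnorm a].
Proof.
(* the empty set is admitted because it is the union of the empty chain *)
pose P G := G = set0 \/ functional_graph a G.
have [Fs FsP tot|G [PG maxG]] := @Zorn_bigcup _ P.
  have [[X0 FX0 X0a]|noX] := pselect (exists2 X, Fs X & functional_graph a X).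
    right; split.
    - by exists X0 => //; case: X0a.
    - move=> x r y s t [X1 F1 h1] [X2 F2 h2].
      have [X [FX k1 k2]] : exists X, [/\ Fs X, X (x, r) & X (y, s)].
        have [h|h] := tot _ _ F1 F2; [exists X2|exists X1]; split=> //; exact: h.
      exists X => //; have [X0'|[_ lX _]] := FsP _ FX; last exact: lX.
      by move: k1; rewrite X0'.
    - move=> x r [X FX h]; have [X0'|[_ _ dX]] := FsP _ FX; last exact: dX.
      by move: h; rewrite X0'.
  left; apply/seteqP; split=> // z [X FX Xz]; exfalso.
  have [X0|X0] := FsP _ FX; first by move: Xz; rewrite X0.
  by apply: noX; exists X.
have fG : functional_graph a G.
  case: PG => // G0; exfalso.
  have h := functional_graph_line a.
  have /maxG : G `<` [set (iota t *: a, t * rnorm a) | t in [set: R]].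
    rewrite G0; split=> [//|/(_ (a, rnorm a))].
    by apply; case: h.
  by apply; right.
have total x : exists r, G (x, r).
  apply: contrapT => nx.
  have [|G' GG' fG'] := functional_graph_extend fG (x0 := x).
    by move=> r h; apply: nx; exists r.
  by apply: (maxG _ GG'); right.
have [f hf] := choice total; case: fG => Ga lG dG.
have flin t x y : f (iota t *: x + y) = t * f x + f y.
  by apply: (graph_functional lG dG (hf _)); exact: lG.
exists f; split=> //; last exact: (graph_functional lG dG (hf _) Ga).
move=> x; rewrite ler_norml dG ?andbT//.
have f0 : f 0 = 0.
  by have := flin (-1) 0 0; rewrite scaler0 addr0; lra.
have := dG _ _ (hf (iota (-1) *: x + 0)); rewrite flin f0.
by rewrite !addr0 rnormZ_real normrN1; lra.
Qed.

End HahnBanach.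

(** Over the complex numbers, [psi x = f x - i f (i x)] with [f] the real-linear
functional of [hahn_banach_real]; the crude bound 2 is enough here. *)
Lemma hahn_banach_nonzero (R : realType) (F : scalar_kind)
    (V : normedModType (scalars R F)) (a : V) : a != 0 ->
  exists psi : V -> (scalars R F)^o,
    [/\ linear psi, forall x, rnorm (psi x) <= 2 * rnorm x & psi a != 0].
Proof.
move: V a; case: F => V a a0; have [f [flin fle fa]] := hahn_banach_real a.
  have na : rnorm a != 0 by rewrite rnorm_eq0.
  exists f; split => //; last by rewrite fa.
  by move=> x; rewrite (le_trans (fle x))// ler_peMl ?rnorm_ge0// ler1n.
have f0 : f 0 = 0.
  by have := flin (-1) 0 0; rewrite scaler0 addr0; lra.
have fZ t x : f (scalar_of ComplexScalars t *: x) = t * f x.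
  by rewrite -[X in f X]addr0 flin f0 addr0.
have fD x y : f (x + y) = f x + f y.
  by have := flin 1 x y; rewrite scalar_of1 scale1r mul1r.
pose i : scalars R ComplexScalars := Complex 0 1.
have fi k x : f (k *: x) = complex.Re k * f x + complex.Im k * f (i *: x).
  rewrite -(fZ (complex.Im k)) -flin; congr f.
  rewrite scalerA -scalerDl; congr (_ *: _).
  by case: k => p q; apply/eqP; rewrite eq_complex /=; apply/andP; split;
     apply/eqP; ring.
have normi : rnorm (i : (scalars R ComplexScalars)^o) = 1.
  change (complex.Re `|Complex (0 : R) 1| = 1).
  by rewrite normc_i.
exists (fun x => Complex (f x) (- f (i *: x))); split.
- move=> k x y; rewrite scalerDr !fD scalerA (fi k) (fi (i * k)).
  by case: k => p q; apply/eqP; rewrite eq_complex /=; apply/andP; split;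
     apply/eqP; ring.
- move=> x; set z := Complex _ _.
  have : rnorm (z : (scalars R ComplexScalars)^o) <= `|f x| + `|f (i *: x)|.
    change (complex.Re `|Complex (f x) (- f (i *: x))| <=
            `|f x| + `|f (i *: x)|).
    by rewrite (le_trans (normc_le_ReIm _ _))// normrN.
  have := fle x; have := fle (i *: x); rewrite rnormZ normi mul1r; lra.
- rewrite eq_complex /= negb_and fa; apply/orP; left.
  by rewrite rnorm_eq0.
Qed.

(** * Finite-dimensional and infinite-dimensional spaces *)

(** Equivalence of norms over the scalar field. In the complex case [d] complex
coordinates are read as [d + d] real ones. *)
Lemma linear_row_bounded (R : realType) (F : scalar_kind)
    (V : normedModType (scalars R F)) d (h : 'rV[scalars R F]_d -> V) :
  linear h -> injective h ->
  exists2 B, 0 <= B & forall (a : 'rV_d) l,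
    rnorm (a 0 l : (scalars R F)^o) <= B * rnorm (h a).
Proof.
move: V h; case: F => V h hlin hinj.
  have hD := linear_mapD hlin; have h0 := linear_map0 hlin.
  have hZ := linear_mapZ hlin.
  have [|c c0 hc] := @is_norm_lower_bound R d (fun a => rnorm (h a)).
    split.
    - by move=> a b; rewrite hD rnormD.
    - by move=> t a; rewrite hZ (rnormZ_real (F := RealScalars) t).
    - by move=> a /eqP; rewrite rnorm_eq0 => /eqP ha; apply: hinj; rewrite ha h0.
  exists c^-1; first by rewrite invr_ge0 ltW.
  by move=> a l; rewrite ler_pdivlMl//; exact: hc.
have hD := linear_mapD hlin; have h0 := linear_map0 hlin.
have hZ := linear_mapZ hlin.
pose j (w : 'rV[R]_(d + d)) : 'rV[scalars R ComplexScalars]_d :=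
  \row_l Complex (w 0 (lshift d l)) (w 0 (rshift d l)).
have [|c c0 hc] := @is_norm_lower_bound R _ (fun w => rnorm (h (j w))).
  split.
  - move=> a b; rewrite (_ : j (a + b) = j a + j b) ?hD ?rnormD//.
    by apply/rowP => l; rewrite !mxE.
  - move=> t a; rewrite -(rnormZ_real (F := ComplexScalars) t) -hZ.
    congr (rnorm (h _)); apply/rowP => l; rewrite !mxE.
    by apply/eqP; rewrite eq_complex /=; apply/andP; split; apply/eqP; ring.
  - move=> a /eqP; rewrite rnorm_eq0 => /eqP ha.
    have {ha} ja : j a = 0 by apply: hinj; rewrite ha h0.
    apply/rowP => i; rewrite mxE; case: (split_ordP i) => l ->;
      by move/rowP/(_ l)/eqP: ja; rewrite !mxE eq_complex /= => /andP[/eqP ? /eqP ?].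
exists (2 / c); first by rewrite divr_ge0// ltW.
move=> a l; pose w : 'rV[R]_(d + d) :=
  row_mx (\row_l complex.Re (a 0 l)) (\row_l complex.Im (a 0 l)).
have jw : j w = a.
  by apply/rowP => k; rewrite mxE row_mxEl row_mxEr !mxE; case: (a 0 k).
have := hc w (lshift d l); have := hc w (rshift d l).
rewrite jw row_mxEl row_mxEr !mxE (mulrAC 2) ler_pdivlMr//.
have : rnorm (a 0 l : (scalars R ComplexScalars)^o) <=
    `|complex.Re (a 0 l)| + `|complex.Im (a 0 l)|.
  by case: (a 0 l) => p q; exact: normc_le_ReIm.
move=> h1 h2 h3; nra.
Qed.

(** A finite-dimensional normed space has a basis [e] with bounded coordinate
functions [g]. *)
Lemma finite_dimensional_coordinates (R : realType) (F : scalar_kind)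
    (V : normedModType (scalars R F)) : finite_dimensional V ->
  exists d (e : 'I_d -> V) (g : 'I_d -> V -> (scalars R F)^o),
    [/\ forall l, linear (g l), forall y, y = \sum_l (g l y : scalars R F) *: e l
      & exists2 B, 0 <= B & forall l y, rnorm (g l y) <= B * rnorm y].
Proof.
move=> [d [[v2r v2r_lin [r2v v2rK r2vK]]]].
have r2v_lin : linear r2v.
  by move=> k a b; apply: (can_inj v2rK); rewrite v2r_lin !r2vK.
have [B B0 hB] := linear_row_bounded r2v_lin (can_inj r2vK).
exists d, (fun l => r2v (delta_mx 0 l)), (fun l y => v2r y 0 l); split.
- by move=> l k x y; rewrite v2r_lin !mxE.
- move=> y; rewrite -[LHS]v2rK [v2r y in LHS]row_sum_delta.
  elim/big_ind2 : _ => [|x1 x2 y1 y2 <- <-|l _].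
  - exact: linear_map0 r2v_lin.
  - exact: linear_mapD r2v_lin _ _.
  - exact: linear_mapZ r2v_lin _ _.
- by exists B => // l y; have := hB (v2r y) l; rewrite v2rK.
Qed.

Lemma infinite_dimensional_free (R : realType) (F : scalar_kind)
    (V : normedModType (scalars R F)) (N : nat) : ~ finite_dimensional V ->
  exists e : 'I_N -> V, forall c : 'I_N -> scalars R F,
    \sum_i c i *: e i = 0 -> forall i, c i = 0.
Proof.
move=> infV; elim: N => [|N [e free_e]]; first by exists (fun=> 0) => c _ [].
have [y0 hy0] : exists y0, forall c, y0 <> \sum_i c i *: e i.
  apply: contrapT => span_e; apply: infV.
  have /choice [g hg] : forall y, exists c, y = \sum_i c i *: e i.
    move=> y; apply: contrapT => hy; apply: span_e; exists y => c yc.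
    by apply: hy; exists c.
  have uniq c y : y = \sum_i c i *: e i -> forall i, g y i = c i.
    move=> yc i; apply/eqP; rewrite -subr_eq0; apply/eqP.
    apply: (free_e (fun i => g y i - c i)).
    under eq_bigr do rewrite scalerBl.
    by rewrite sumrB -hg -yc subrr.
  exists N; constructor; exists (fun y => \row_i g y i).
    move=> k x y; apply/rowP => i; rewrite !mxE; apply: (uniq (fun i => _ * _ + _)).
    under eq_bigr do rewrite scalerDl -scalerA.
    by rewrite big_split /= -scaler_sumr -!hg.
  exists (fun a : 'rV_N => \sum_i a 0 i *: e i).
    by move=> y; rewrite [RHS]hg; apply: eq_bigr => i _; rewrite mxE.
  by move=> a; apply/rowP => i; rewrite mxE; exact: (uniq (fun i => a 0 i)).
exists (fun i => if unlift ord0 i is Some j then e j else y0) => c.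
rewrite big_ord_recl unlift_none.
under eq_bigr do rewrite liftK.
move=> c0; have c00 : c ord0 = 0.
  apply/eqP; apply: contraT => nz; exfalso.
  apply: (hy0 (fun i => - (c ord0)^-1 * c (lift ord0 i))).
  under eq_bigr do rewrite -scalerA.
  move/eqP: c0; rewrite -scaler_sumr addrC addr_eq0 => /eqP ->.
  by rewrite scalerN scaleNr opprK scalerA mulVf// scale1r.
move: c0; rewrite c00 scale0r add0r => c0 i.
by case: (unliftP ord0 i) => [j|] ->//; exact: (free_e (fun j => c (lift ord0 j))).
Qed.

(** * Multilinear maps *)

Section Multilinear.
Variables (R : realType) (F : scalar_kind) (n : nat).
Local Notation K := (scalars R F).
Local Notation iota := (scalar_of (R := R) F).
Variables (X Y : normedModType K).
Implicit Types (T : ('I_n -> X) -> Y) (x : 'I_n -> X).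

Lemma multilinear_slotZ T x k (c : K) u : @multilinear R F n (fun=> X) Y T ->
  T (dfwith x k (c *: u)) = c *: T (dfwith x k u).
Proof. by move=> linT; exact: (linear_mapZ (linT k x) c u). Qed.

Lemma multilinear_slot0 T x k : @multilinear R F n (fun=> X) Y T ->
  T (dfwith x k 0) = 0.
Proof. by move=> linT; exact: (linear_map0 (linT k x)). Qed.

(** Homogeneity of degree [n], scaling one slot after the other. *)
Lemma multilinear_scale T x (c : K) : @multilinear R F n (fun=> X) Y T ->
  T (fun k => c *: x k) = c ^+ n *: T x.
Proof.
move=> linT.
suff H j : (j <= n)%N ->
    T (fun k : 'I_n => if (k < j)%N then c *: x k else x k) = c ^+ j *: T x.
  by rewrite -H//; congr T; apply/funext => k; rewrite ltn_ord.
elim: j => [_|j IH jn]; first by rewrite expr0 scale1r.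
pose k0 : 'I_n := Ordinal jn.
pose z (k : 'I_n) := if (k < j)%N then c *: x k else x k.
have -> : (fun k : 'I_n => if (k < j.+1)%N then c *: x k else x k) =
    dfwith z k0 (c *: x k0).
  apply/funext => k; case: dfwithP => [|k' kk']; first by rewrite /= ltnSn.
  rewrite /z ltnS leq_eqVlt (_ : (nat_of_ord k' == j) = false)//.
  by apply/negbTE; rewrite eq_sym; apply: contra_neq kk' => h; exact: val_inj.
rewrite (multilinear_slotZ z k0 c (x k0) linT) exprS -scalerA -(IH (ltnW jn)).
congr (_ *: T _).
apply/funext => k; case: dfwithP => // .
by rewrite /z ltnn.
Qed.

Lemma multilinear0 T : (0 < n)%N -> @multilinear R F n (fun=> X) Y T ->
  T (fun=> 0) = 0.
Proof.
move=> n0 linT; have := multilinear_scale (fun=> 0) 0 linT.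
by rewrite expr0n gtn_eqF//= !scale0r.
Qed.

(** Continuity at the origin bounds a multilinear map on the unit ball: if
[rnorm (T (x t)) > (t + 1)^n] with all [x t] in the unit ball, then
[x t / (t + 1)] tends to 0 whereas its image stays outside the unit ball. *)
Lemma continuous_multilinear_bounded T : (0 < n)%N ->
  @continuous_multilinear R F n (fun=> X) Y T ->
  exists2 M, 0 <= M &
    forall x, (forall k, rnorm (x k) <= 1) -> rnorm (T x) <= M.
Proof.
move=> n0 [linT contT]; apply: contrapT => nbnd.
have /choice [x hx] : forall t : nat, exists x,
    (forall k, rnorm (x k) <= 1) /\ t.+1%:R ^+ n < rnorm (T x).
  move=> t; apply: contrapT => nx; apply: nbnd.
  exists (t.+1%:R ^+ n); first by rewrite exprn_ge0.
  by move=> x x1; rewrite leNgt; apply/negP => h; apply: nx; exists x.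
pose z (t : nat) : prod_topology (fun _ : 'I_n => X) :=
  fun k => iota (t.+1%:R)^-1 *: x t k.
have z0 : z @ \oo --> ((fun=> 0) : prod_topology (fun _ : 'I_n => X)).
  apply: cvg_prod_topology => k; apply/cvg_rnormP => e e0.
  apply: filterS (near_infty_natSinv_lt (PosNum e0)) => t /= te.
  rewrite sub0r rnormN rnormZ_real ger0_norm ?invr_ge0//.
  by rewrite (le_lt_trans _ te)// ler_piMr ?invr_ge0//; case: (hx t).
have Tz : T (z t) @[t --> \oo] --> T (fun=> 0).
  have cT := contT (fun=> 0). exact: (@cvg_comp _ _ _ z T _ _ _ z0 cT).
have /cvg_rnormP/(_ 1 ltr01) := Tz.
rewrite (multilinear0 n0 linT) /= => -[N _ /(_ N (leqnn N))] /=.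
rewrite sub0r rnormN (multilinear_scale _ _ linT) -scalar_ofX rnormZ_real.
rewrite ger0_norm ?exprn_ge0 ?invr_ge0// exprVn ltNge => /negP; apply.
by rewrite ler_pdivlMl ?exprn_gt0// mulr1 ltW//; case: (hx N).
Qed.

Lemma multilinear_norm_le1 (phi : ('I_n -> X) -> Y) :
  (@multilinear_norm R F n (fun=> X) Y phi <= 1%:E)%E <->
  forall x, (forall k, rnorm (x k) <= 1) -> rnorm (phi x) <= 1.
Proof.
split=> [h x x1|h].
  by rewrite -lee_fin (le_trans _ h)//; apply: ereal_sup_ubound; exists x.
by apply: ge_ereal_sup => _ [x x1 <-]; rewrite lee_fin h.
Qed.

(** Freezing all slots but one at a vector of the unit ball turns a multilinear
map of norm at most 1 into a linear contraction. *)
Lemma multilinear_norm_slice (phi : ('I_n -> X) -> Y) (a : X) k y :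
  @multilinear R F n (fun=> X) Y phi ->
  (@multilinear_norm R F n (fun=> X) Y phi <= 1%:E)%E -> rnorm a <= 1 ->
  rnorm (phi (dfwith (fun=> a) k y)) <= rnorm y.
Proof.
move=> phi_lin /multilinear_norm_le1 phi1 a1.
have [->|y0] := eqVneq y 0.
  by rewrite (multilinear_slot0 _ _ phi_lin) !rnorm0.
have ny : 0 < rnorm y by rewrite lt_neqAle eq_sym rnorm_eq0 y0 rnorm_ge0.
have : rnorm (phi (dfwith (fun=> a) k (iota (rnorm y)^-1 *: y))) <= 1.
  apply: phi1 => j; case: dfwithP => // .
  by rewrite rnormZ_real ger0_norm ?invr_ge0 ?rnorm_ge0// mulVf// gt_eqF.
rewrite (multilinear_slotZ _ _ _ _ phi_lin) rnormZ_real.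
rewrite ger0_norm ?invr_ge0 ?rnorm_ge0//.
by rewrite ler_pdivrMl// mulr1.
Qed.

End Multilinear.

(** * Sums of powers *)

Section PowerSums.
Variable R : realType.
Implicit Types (p c : R).

Lemma powR_rootK p c : 0 < p -> 0 <= c -> (c `^ p) `^ p^-1 = c.
Proof. by move=> p0 c0; rewrite -powRrM mulfV ?gt_eqF// powRr1. Qed.

Lemma powR_rootVK p c : 0 < p -> 0 <= c -> (c `^ p^-1) `^ p = c.
Proof. by move=> p0 c0; rewrite -powRrM mulVf ?gt_eqF// powRr1. Qed.

Lemma lp_root_ge p (I : finType) (v : I -> R) i : 0 < p ->
  (forall i, 0 <= v i) -> v i <= (\sum_i v i `^ p) `^ p^-1.
Proof.
move=> p0 v0; rewrite -[leLHS](powR_rootK p0 (v0 i)).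
apply: ge0_ler_powR.
- by rewrite invr_ge0 ltW.
- by rewrite nnegrE powR_ge0.
- by rewrite nnegrE sumr_ge0// => j _; exact: powR_ge0.
by rewrite (bigD1 i)//= lerDl sumr_ge0// => j _; exact: powR_ge0.
Qed.

Lemma powR_sum_le p d (v : 'I_d -> R) : 0 < p -> (forall i, 0 <= v i) ->
  (\sum_i v i) `^ p <= d%:R `^ p * \sum_i v i `^ p.
Proof.
move=> p0 v0; set t := (\sum_i v i `^ p) `^ p^-1.
have S0 : 0 <= \sum_i v i `^ p by apply: sumr_ge0 => i _; exact: powR_ge0.
have -> : \sum_i v i `^ p = t `^ p by rewrite powR_rootVK.
rewrite -powRM ?powR_ge0//; apply: ge0_ler_powR; rewrite ?nnegrE ?(ltW p0)//.
- by apply: sumr_ge0.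
- by rewrite mulr_ge0 ?powR_ge0.
- rewrite (le_trans (ler_sum _ (fun i _ => lp_root_ge i p0 v0)))//.
  by rewrite sumr_const card_ord mulr_natl.
Qed.

(** A coarse substitute for Minkowski's inequality: the sum of the l^p norms on
the right is only asked to dominate up to a constant depending on [d]. *)
Lemma lp_norm_le_sum p m d (c : R) (w : 'I_m -> R) (v : 'I_m -> 'I_d -> R) :
  1 <= p -> 0 <= c -> (forall j, 0 <= w j) -> (forall j l, 0 <= v j l) ->
  (forall j, w j <= c * \sum_l v j l) ->
  (\sum_j w j `^ p) `^ p^-1 <=
    c * d%:R ^+ 2 * \sum_l (\sum_j v j l `^ p) `^ p^-1.
Proof.
move=> p1 c0 w0 v0 wv; have p0 : 0 < p by exact: lt_le_trans p1.
pose W l := (\sum_j v j l `^ p) `^ p^-1; pose S := \sum_l W l.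
have S0 : 0 <= S by apply: sumr_ge0 => l _; exact: powR_ge0.
have cS : 0 <= c * d%:R ^+ 2 * S by rewrite !mulr_ge0// exprn_ge0.
rewrite -[leRHS](powR_rootK p0 cS); apply: ge0_ler_powR.
- by rewrite invr_ge0 ltW.
- by rewrite nnegrE sumr_ge0// => j _; exact: powR_ge0.
- by rewrite nnegrE powR_ge0.
apply: (@le_trans _ _ (\sum_j (c * d%:R) `^ p * \sum_l v j l `^ p)).
  apply: ler_sum => j _.
  apply: (@le_trans _ _ ((c * \sum_l v j l) `^ p)).
    apply: ge0_ler_powR; rewrite ?nnegrE ?(ltW p0)//.
    by rewrite mulr_ge0// sumr_ge0.
  rewrite !powRM// ?sumr_ge0// -mulrA ler_wpM2l ?powR_ge0//.
  exact: powR_sum_le.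
rewrite -mulr_sumr exchange_big /=.
rewrite expr2 (mulrA c) -mulrA [leRHS]powRM ?mulr_ge0//.
rewrite ler_wpM2l ?powR_ge0//.
have WS l : \sum_j v j l `^ p <= S `^ p.
  rewrite -[leLHS](powR_rootVK p0); last first.
    by apply: sumr_ge0 => j _; exact: powR_ge0.
  apply: ge0_ler_powR; rewrite ?nnegrE ?(ltW p0) ?powR_ge0//.
  by rewrite /S (bigD1 l)//= lerDl sumr_ge0// => k _; exact: powR_ge0.
rewrite (le_trans (ler_sum _ (fun l _ => WS l)))//.
rewrite sumr_const card_ord -[leLHS]mulr_natl powRM//.
rewrite ler_wpM2r ?powR_ge0//.
case: d {W S S0 cS WS v v0 wv} => [|d]; first by rewrite powR_ge0.
by rewrite -[leLHS]powRr1// ler_powR// ler1n.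
Qed.

End PowerSums.

(** * Finite dimension implies summability *)

Section FiniteDimensional.
Variables (R : realType) (F : scalar_kind) (n : nat).
Local Notation K := (scalars R F).
Local Notation iota := (scalar_of (R := R) F).

Lemma zero_unit_form (X : normedModType K) :
  @unit_forms R F n (fun=> X) (fun=> 0).
Proof.
split; first split.
- by move=> k x c u v; rewrite /= scaler0 addr0.
- exact: (@cst_continuous (prod_topology (fun _ : 'I_n => X)) K^o 0).
- by apply/multilinear_norm_le1 => x _; rewrite rnorm0.
Qed.

Lemma finite_dimensional_factorable (p : R) (Y : completeNormedModType K)
    (T : ('I_n -> Y) -> Y) : 1 <= p -> (0 < n)%N -> finite_dimensional Y ->
  @continuous_multilinear R F n (fun=> Y) Y T ->
  @factorable_strongly_summing R F n (fun=> Y) Y p T.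
Proof.
move=> p1 n0 finY cmT; have [linT contT] := cmT.
have [d [e [g [g_lin gE [B B0 gB]]]]] := finite_dimensional_coordinates finY.
have [M M0 TM] := continuous_multilinear_bounded n0 cmT.
pose M' := B * M + 1; have M'0 : 0 < M' by rewrite ltr_wpDl// mulr_ge0.
pose phi l (x : 'I_n -> Y) : K^o := iota M'^-1 *: g l (T x).
have phi_unit l : @unit_forms R F n (fun=> Y) (phi l).
  split; first split.
  - move=> k x c u v; rewrite /phi (linT k x c u v) g_lin scalerDr.
    by rewrite !scalerA mulrC.
  - apply: (bounded_linear_comp_continuous (f := fun y => iota M'^-1 *: g l y)
      (L := M'^-1 * B) _ _ _ contT).
    + by rewrite mulr_ge0// invr_ge0 ltW.
    + by move=> k u v; rewrite g_lin scalerDr !scalerA mulrC.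
    + move=> y; rewrite rnormZ_real gtr0_norm ?invr_gt0// -mulrA.
      by rewrite ler_wpM2l ?gB// invr_ge0 ltW.
  - apply/multilinear_norm_le1 => x x1.
    rewrite /phi rnormZ_real gtr0_norm ?invr_gt0// ler_pdivrMl// mulr1.
    have := gB l (T x); have := TM x x1; rewrite /M'; nra.
pose E := \sum_l rnorm (e l).
have E0 : 0 <= E by apply: sumr_ge0 => l _; exact: rnorm_ge0.
pose c := M' * E; have c0 : 0 <= c by rewrite mulr_ge0// ltW.
have cd0 : 0 <= c * d%:R ^+ 2 by rewrite mulr_ge0// exprn_ge0.
have cdd0 : 0 <= c * d%:R ^+ 2 * d%:R by rewrite mulr_ge0.
(* adding 1 makes the constant positive, so that it can multiply an infinite
   supremum *)
exists (c * d%:R ^+ 2 * d%:R + 1); first by rewrite addr_ge0.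
move=> m1 m2 _ _ x lambda.
pose v j l := rnorm (\sum_(i < m2) lambda j i *: phi l (x j i)).
set w := fun j : 'I_m1 => rnorm (\sum_(i < m2) lambda j i *: T (x j i)).
have wv j : w j <= c * \sum_l v j l.
  rewrite /w (gE (\sum_i _)) (le_trans (rnorm_sum _ _ _))// mulr_sumr.
  apply: ler_sum => l _; rewrite rnormZ (linear_map_sum (g_lin l)).
  have -> : \sum_i lambda j i *: g l (T (x j i)) =
      iota M' *: \sum_i lambda j i *: phi l (x j i).
    rewrite scaler_sumr; apply: eq_bigr => i _.
    rewrite /phi !scalerA mulrAC -scalar_ofM mulfV ?gt_eqF//.
    by rewrite scalar_of1 mul1r.
  rewrite rnormZ_real gtr0_norm// /c -/(v j l).
  have eE : rnorm (e l) <= E.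
    by rewrite /E (bigD1 l)//= lerDl sumr_ge0// => k _; exact: rnorm_ge0.
  rewrite mulrAC -2!mulrA ler_pM2l// ler_wpM2r// rnorm_ge0//.
have bound := lp_norm_le_sum p1 c0 (fun j => rnorm_ge0 _)
  (fun j l => rnorm_ge0 _) wv.
set s := ereal_sup _.
(* the zero form covers the case [d = 0], where no [phi l] is available *)
have s0 : (0 <= s)%E.
  apply: (@le_trans _ _ ((\sum_(j < m1)
      rnorm (\sum_(i < m2) lambda j i *: (0 : K^o)) `^ p) `^ p^-1)%:E).
    by rewrite lee_fin powR_ge0.
  by apply: ereal_sup_ubound; exists (fun=> 0) => //; exact: zero_unit_form.
have vs l : (((\sum_j v j l `^ p) `^ p^-1)%:E <= s)%E.
  by apply: ereal_sup_ubound; exists (phi l).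
case: s s0 vs => [r| |//].
  rewrite lee_fin => r0 vs; rewrite -EFinM lee_fin (le_trans bound)//.
  have S_le : \sum_l (\sum_j v j l `^ p) `^ p^-1 <= d%:R * r.
    rewrite mulr_natl -[X in _ *+ X]card_ord -sumr_const; apply: ler_sum => l _.
    by rewrite -lee_fin.
  rewrite (le_trans (ler_wpM2l cd0 S_le))//; lra.
by move=> _ _; rewrite gt0_muley ?leey// lte_fin ltr_wpDl.
Qed.

End FiniteDimensional.

(** * Infinite dimension prevents summability *)

Section InfiniteDimensional.
Variables (R : realType) (F : scalar_kind).
Local Notation K := (scalars R F).
Local Notation iota := (scalar_of (R := R) F).

(** [dvoretzky_rogers] for the norm induced on the real span of [m + m] linearly
independent vectors. *)
Lemma dvoretzky_rogers_family (V : normedModType K) (m : nat) :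
  ~ finite_dimensional V ->
  exists y : 'I_m -> V, (forall s, 1 <= 16 * rnorm (y s) ^+ 2) /\
    forall b : 'I_m -> R,
      rnorm (\sum_s iota (b s) *: y s) ^+ 2 <= \sum_s b s ^+ 2.
Proof.
move=> infV; have [e free_e] := infinite_dimensional_free (m + m) infV.
pose J (a : 'rV[R]_(m + m)) : V := \sum_l iota (a 0 l) *: e l.
have JD a b : J (a + b) = J a + J b.
  by rewrite /J -big_split; apply: eq_bigr => l _; rewrite mxE scalar_ofD scalerDl.
have JZ t a : J (t *: a) = iota t *: J a.
  rewrite /J scaler_sumr; apply: eq_bigr => l _.
  by rewrite mxE scalar_ofM scalerA.
have J0 : J 0 = 0 by rewrite -(scale0r (0 : 'rV[R]_(m + m))) JZ scalar_of0 scale0r.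
have J_norm : is_norm (fun a => rnorm (J a)).
  split=> [a b|t a|a /eqP].
  - by rewrite JD rnormD.
  - by rewrite JZ rnormZ_real.
  - rewrite rnorm_eq0 => /eqP Ja; apply/rowP => l; rewrite mxE; apply/eqP.
    by rewrite -(scalar_of_eq0 F) (free_e (fun l => iota (a 0 l))).
have [A cA hA] := dvoretzky_rogers J_norm.
exists (fun s => J (row (lshift m s) A)); split.
  by move=> s; apply: hA => /=.
move=> b; pose a : 'rV[R]_(m + m) := row_mx (\row_s b s) 0.
have -> : \sum_s iota (b s) *: J (row (lshift m s) A) = J (a *m A).
  rewrite mulmx_sum_row big_split_ord /=.
  rewrite [X in _ = J (_ + X)]big1 ?addr0; last first.
    by move=> s _; rewrite row_mxEr mxE scale0r.
  rewrite (big_morph J JD J0); apply: eq_bigr => s _.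
  by rewrite JZ row_mxEl mxE.
rewrite (le_trans (cA a))// /sqn big_split_ord /=.
rewrite [X in _ + X]big1 ?addr0; last first.
  by move=> s _; rewrite row_mxEr mxE expr0n.
by apply: ler_sum => s _; rewrite row_mxEl mxE.
Qed.

(** Vectors [y s] whose real combinations satisfy the bound of
[dvoretzky_rogers_family] have uniformly small sums against linear forms. *)
Section WeakSum.
Variables (V : normedModType K) (m : nat) (y : 'I_m -> V).
Hypothesis y_weak : forall b : 'I_m -> R,
  rnorm (\sum_s iota (b s) *: y s) ^+ 2 <= \sum_s b s ^+ 2.

(** By duality: with [b s] the real part of [f (y s)], the sum [S] in question is
the real part of [f (\sum_s b s *: y s)], hence [S <= S^(1/2)]. *)
Lemma weak_sum_re (f : V -> K^o) : linear f ->
  (forall v, rnorm (f v) <= rnorm v) ->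
  \sum_s scalar_re (f (y s) : K) ^+ 2 <= 1.
Proof.
move=> f_lin f1; set S := \sum_s _.
pose b s := scalar_re (f (y s) : K).
have fS : scalar_re (f (\sum_s iota (b s) *: y s) : K) = S.
  rewrite (linear_map_sum f_lin).
  have re0 : scalar_re (0 : K) = 0 by rewrite -scalar_of0 scalar_re_of.
  rewrite (big_morph (@scalar_re R F) (@scalar_reD R F) re0).
  by apply: eq_bigr => s _; rewrite scalar_reM expr2.
have S0 : 0 <= S by apply: sumr_ge0 => s _; exact: sqr_ge0.
have h1 : S <= rnorm (\sum_s iota (b s) *: y s).
  rewrite (le_trans _ (f1 _))// -[leLHS]fS.
  by rewrite (le_trans (ler_norm _))// scalar_re_le.
have := y_weak b; rewrite -/S; have := rnorm_ge0 (\sum_s iota (b s) *: y s).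
set t := rnorm _ in h1 *; nra.
Qed.

Lemma weak_sum_sqr (f : V -> K^o) : linear f ->
  (forall v, rnorm (f v) <= rnorm v) ->
  \sum_s rnorm (f (y s)) ^+ 2 <= 4.
Proof.
move=> f_lin f1; have [u [nu hu]] := scalar_imaginary_unit R F.
have h1 := weak_sum_re f_lin f1.
have h2 : \sum_s scalar_re (u * f (y s) : K) ^+ 2 <= 1.
  apply: (weak_sum_re (f := fun v => u *: f v)).
    by move=> k v w; rewrite f_lin scalerDr !scalerA mulrC.
  move=> v; rewrite rnormZ (_ : rnorm (u : K^o) = 1) ?mul1r//.
  by rewrite /rnorm nu -(scalar_of1 R F) scalar_re_of.
apply: (@le_trans _ _ (2 * (\sum_s scalar_re (f (y s) : K) ^+ 2 +
    \sum_s scalar_re (u * f (y s) : K) ^+ 2))); last by lra.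
rewrite -big_split /= mulr_sumr; apply: ler_sum => s _.
have := hu (f (y s)); rewrite -/(rnorm (f (y s))).
have := rnorm_ge0 (f (y s)).
rewrite -[scalar_re (f (y s)) ^+ 2]real_normK ?num_real//.
rewrite -[scalar_re (u * _) ^+ 2]real_normK ?num_real//.
have := normr_ge0 (scalar_re (f (y s))).
have := normr_ge0 (scalar_re (u * f (y s))).
set a := `|_|; set b := `|_|; set t := rnorm _ => b0 a0 t0 tab.
have := sqr_ge0 (a - b); nra.
Qed.

(** Each [t = rnorm (f (y s))] is at most 1, so that [t^p <= t <= al + t^2 / al];
the free parameter [al] makes the bound [o(m)]. *)
Lemma weak_sum_powR (p al : R) (f : V -> K^o) : 1 <= p -> 0 < al ->
  linear f -> (forall v, rnorm (f v) <= rnorm v) ->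
  (\sum_s rnorm (f (y s)) `^ p) <= m%:R * al + 4 / al.
Proof.
move=> p1 al0 f_lin f1; have h := weak_sum_sqr f_lin f1.
have le1 s : rnorm (f (y s)) <= 1.
  rewrite (le_trans (f1 _))// -(ler_pXn2r (n := 2))// ?nnegrE ?rnorm_ge0// expr1n.
  have := y_weak (fun i => (i == s)%:R).
  rewrite (bigD1 s)//= eqxx scalar_of1 scale1r big1 ?addr0; last first.
    by move=> i /negbTE ->; rewrite scalar_of0 scale0r.
  rewrite (bigD1 s)//= eqxx expr1n big1 ?addr0//.
  by move=> i /negbTE ->; rewrite expr0n.
apply: (@le_trans _ _ (\sum_s (al + rnorm (f (y s)) ^+ 2 / al))).
  apply: ler_sum => s _; set t := rnorm _.
  have t0 : 0 <= t := rnorm_ge0 _.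
  apply: (@le_trans _ _ t).
    have [->|tn0] := eqVneq t 0; first by
      rewrite powR0// gt_eqF// (lt_le_trans _ p1).
    rewrite -[leRHS]powRr1// ger_powR// le1 andbT lt_neqAle eq_sym tn0//.
  rewrite -(ler_pM2r al0) mulrDl divfK ?gt_eqF//.
  have := sqr_ge0 (t - al); nra.
rewrite big_split /= sumr_const card_ord mulr_natl lerD2l -mulr_suml.
by rewrite ler_pM2r ?invr_gt0.
Qed.

End WeakSum.

Section TestOperator.
Variables (n : nat) (Y : normedModType K) (psi : Y -> K^o) (k0 : 'I_n).
Hypothesis psi_lin : linear psi.
Hypothesis psi_bnd : forall x, rnorm (psi x) <= 2 * rnorm x.

(** The slot [k0] carries the identity, all other slots the linear form [psi]. *)
Definition test_operator (x : 'I_n -> Y) : Y :=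
  (\prod_(k | k != k0) (psi (x k) : K)) *: x k0.

Lemma test_operator_multilinear :
  @multilinear R F n (fun=> Y) Y test_operator.
Proof.
move=> k x c u v; rewrite /test_operator.
have [->|kk0] := eqVneq k k0.
  rewrite !dfwithin scalerDr scalerA mulrC -scalerA.
  by congr (_ *: (_ *: _) + _ *: _); apply: eq_bigr => j jk0;
     rewrite !dfwithout// eq_sym.
rewrite !(bigD1 k (P := fun k => k != k0))//= !dfwithin !(dfwithout _ _ kk0).
set P1 := \prod_(_ | _) _; set P2 := \prod_(_ | _) _; set P3 := \prod_(_ | _) _.
have P12 : P1 = P2.
  by apply: eq_bigr => j /andP[_ jk]; rewrite !dfwithout// eq_sym.
have P13 : P1 = P3.
  by apply: eq_bigr => j /andP[_ jk]; rewrite !dfwithout// eq_sym.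
rewrite -P12 -P13 psi_lin mulrDl scalerDl; congr (_ + _).
by rewrite -[in LHS]mulrA -[LHS]scalerA.
Qed.

Lemma test_operator_continuous :
  continuous (test_operator : prod_topology (fun _ : 'I_n => Y) -> Y).
Proof.
have psi_cont : continuous psi.
  have id_cont : continuous (id : Y -> Y) by move=> z; exact: cvg_id.
  exact: (bounded_linear_comp_continuous _ psi_lin psi_bnd id_cont).
move=> x.
have cp k : (fun z : prod_topology (fun _ : 'I_n => Y) => z k) @ x --> x k.
  exact: (@proj_continuous _ (fun _ : 'I_n => Y) k x).
apply: (@cvgZ K Y _ (nbhs x) (nbhs_filter x) _ _ _ _ _ (cp k0)).
apply: (@cvg_big K _ _ 1 _ (@mul_continuous K) _ (nbhs x)) => k _.
exact: (@cvg_comp _ _ _ _ psi _ _ _ (cp k) (psi_cont (x k))).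
Qed.

Lemma test_operator_slice a y :
  test_operator (dfwith (fun=> a) k0 y) = (psi a : K) ^+ n.-1 *: y.
Proof.
rewrite /test_operator dfwithin (eq_bigr (fun=> psi a : K)); last first.
  by move=> k kk0; rewrite dfwithout// eq_sym.
by rewrite prodr_const cardC1 card_ord.
Qed.

End TestOperator.

Lemma infinite_dimensional_not_factorable (p : R) (n : nat)
    (Y : completeNormedModType K) : 1 <= p -> (0 < n)%N ->
  ~ finite_dimensional Y ->
  exists2 T : ('I_n -> Y) -> Y, @continuous_multilinear R F n (fun=> Y) Y T &
    ~ @factorable_strongly_summing R F n (fun=> Y) Y p T.
Proof.
move=> p1 n0 infY; have p0 : 0 < p by exact: lt_le_trans p1.
have [a a1] : exists a : Y, rnorm a = 1.
  have [e free_e] := infinite_dimensional_free 1 infY.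
  have e0 : e 0 != 0.
    apply/eqP => e0; have /eqP := oner_eq0 K; rewrite (free_e (fun=> 1) _ 0)//.
    by rewrite big_ord1 e0 scaler0.
  exists (iota (rnorm (e 0))^-1 *: e 0).
  by rewrite rnormZ_real ger0_norm ?invr_ge0 ?rnorm_ge0// mulVf// rnorm_eq0.
have a0 : a != 0 by rewrite -rnorm_eq0 a1 oner_eq0.
have [psi [psi_lin psi_bnd psia]] := hahn_banach_nonzero a0.
pose k0 : 'I_n := Ordinal n0.
(* the tuples used are [y j] in the slot [k0] and [a] elsewhere, with [m2 = 1] *)
exists (test_operator psi k0).
  split; first exact: test_operator_multilinear.
  exact: test_operator_continuous.
move=> [C C0 hC].
pose rho := rnorm ((psi a : K) ^+ n.-1 : K^o).
have rho0 : 0 < rho.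
  by rewrite lt_neqAle rnorm_ge0 andbT eq_sym rnorm_eq0 expf_neq0.
pose kap := (rho / 4) `^ p; have kap0 : 0 < kap by rewrite powR_gt0// divr_gt0.
have main (m : nat) (al : R) : (0 < m)%N -> 0 < al ->
    m%:R * kap <= C `^ p * (m%:R * al + 4 / al).
  move=> m0 al0; have [y [ybig yweak]] := dvoretzky_rogers_family m infY.
  have := hC m 1%N m0 isT (fun j _ => dfwith (fun=> a) k0 (y j)) (fun _ _ => 1).
  set U := m%:R * al + 4 / al.
  have U0 : 0 <= U by rewrite addr_ge0 ?divr_ge0 ?mulr_ge0 ?(ltW al0).
  set s := ereal_sup _; set L := (X in (X%:E <= _)%E -> _) => LCs.
  have sU : (s <= (U `^ p^-1)%:E)%E.
    apply: ge_ereal_sup => _ [phi [[phi_lin _] phi1] <-]; rewrite lee_fin.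
    apply: ge0_ler_powR.
    - by rewrite invr_ge0 ltW.
    - by rewrite nnegrE sumr_ge0// => j _; exact: powR_ge0.
    - by rewrite nnegrE.
    under eq_bigr do rewrite big_ord1 scale1r.
    apply: (weak_sum_powR yweak p1 al0
      (f := fun v => phi (dfwith (fun=> a) k0 v))).
      exact: (phi_lin k0 (fun=> a)).
    by move=> v; apply: multilinear_norm_slice; rewrite ?a1.
  have {LCs sU} LU : L <= C * U `^ p^-1.
    by rewrite -lee_fin EFinM (le_trans LCs)// lee_wpmul2l// lee_fin.
  have Lp : L `^ p <= C `^ p * U.
    rewrite -[X in _ * X](powR_rootVK p0 U0) -powRM ?powR_ge0//.
    by apply: ge0_ler_powR; rewrite ?nnegrE ?powR_ge0 ?mulr_ge0 ?powR_ge0 ?(ltW p0).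
  rewrite (le_trans _ Lp)// /L powR_rootVK//; last first.
    by apply: sumr_ge0 => j _; exact: powR_ge0.
  rewrite mulr_natl -[X in _ *+ X]card_ord -sumr_const; apply: ler_sum => j _.
  rewrite big_ord1 scale1r test_operator_slice rnormZ -/rho.
  apply: ge0_ler_powR;
    rewrite ?nnegrE ?(ltW p0) ?divr_ge0 ?mulr_ge0 ?(ltW rho0) ?rnorm_ge0//.
  rewrite ler_pM2l//.
  have := ybig j; have := rnorm_ge0 (y j); nra.
(* for large [m] the two sides compare as [m * kap] and [m * kap / 2 + Q] *)
pose D := C `^ p; have D0 : 0 <= D by exact: powR_ge0.
pose al := kap / (2 * (D + 1)).
have D1 : 0 < 2 * (D + 1) by rewrite mulr_gt0// ltr_wpDl.
have al0 : 0 < al by rewrite divr_gt0.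
have Dal : D * al <= kap / 2.
  rewrite /al mulrA ler_pdivrMr//; nra.
pose Q := D * (4 / al); have Q0 : 0 <= Q by rewrite mulr_ge0// divr_ge0// ltW.
have Qk0 : 0 <= 2 * Q / kap.
  exact: divr_ge0 (mulr_ge0 (ler0n _ 2) Q0) (ltW kap0).
have [m hm] : exists m : nat, 2 * Q / kap < m%:R.
  by exists (Num.bound (2 * Q / kap)); exact: archi_boundP.
have m0 : (0 < m)%N by rewrite -(ltr_nat R) (le_lt_trans _ hm).
have := main m al m0 al0; rewrite -/D mulrDr -/Q.
rewrite ltr_pdivrMr// in hm.
have : m%:R * (D * al) <= m%:R * (kap / 2) by rewrite ler_wpM2l.
lra.
Qed.

End InfiniteDimensional.

Theorem theorem5p7 (R : realType) (F : scalar_kind) (p : R) (n : nat)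
    (Y : completeNormedModType (scalars R F)) (hp : 1 <= p) (hn : (1 <= n)%N) :
  (forall T : ('I_n -> Y) -> Y,
      @continuous_multilinear R F n (fun=> Y) Y T ->
      @factorable_strongly_summing R F n (fun=> Y) Y p T)
  <-> finite_dimensional Y.
Proof.
split=> [factT|finY T cmT]; last exact: finite_dimensional_factorable.
apply: contrapT => infY.
have [T cmT nfT] := infinite_dimensional_not_factorable hp hn infY.
exact: nfT (factT T cmT).
Qed.
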